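(* Let $\nu$ be a compactly supported Borel probability measure on $\mathbb{R}^n$, let $E\subseteq\operatorname{supp}\nu$, and assume that $\pi(E)>0$, where $\pi=\mathsf{H}^{1,0}_\nu$. Then $$\underline{\dim}_{MB}(E)\geq \operatorname*{ess\,sup}_{x\in E}\underline{\alpha}_{\nu}(x)\quad\text{and}\quad \overline{\dim}_{MB}(E)\geq \operatorname*{ess\,sup}_{x\in E}\overline{\alpha}_{\nu}(x),$$ where the essential suprema are taken with respect to $\pi$.
   Context: $B(x,r)$ denotes the open ball of center $x$ and radius $r$ in $\mathbb{R}^n$. Hewitt-Stromberg dimensions. For $E\subseteq\mathbb{R}^n$ and $r>0$, let $N_r(E)$ be the infimum of the cardinalities of families of open balls $B(x_i,r)$ with $x_i\in E$ that cover $E$, and $M_r(E)$ the supremum of the cardinalities of families of pairwise disjoint open balls $B(x_i,r)$ with $x_i\in E$. Put $\mathsf{L}^t(E)=\liminf_{r\to0}N_r(E)(2r)^t$, $\overline{\mathsf{H}}^t(E)=\sup_{F\subseteq E}\mathsf{L}^t(F)$, $\overline{\mathsf{P}}^t(E)=\limsup_{r\to0}M_r(E)(2r)^t$, and (infima over countable covers) $\mathsf{H}^t(E)=\inf\{\sum_i\overline{\mathsf{H}}^t(E_i): E\subseteq\bigcup_iE_i\}$, $\mathsf{P}^t(E)=\inf\{\sum_i\overline{\mathsf{P}}^t(E_i): E\subseteq\bigcup_iE_i\}$. Then $\underline{\dim}_{MB}(E)=\inf\{t\ge0:\mathsf{H}^t(E)=0\}$ and $\overline{\dim}_{MB}(E)=\inf\{t\ge0:\mathsf{P}^t(E)=0\}$.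 The outer measure $\pi$. A centered covering of $E$ by balls of radius $r$ is a family of balls $B(x_i,r)$ with $x_i\in E$ covering $E$. For $E\subseteq\operatorname{supp}\nu$ let $N^1_{\nu,r}(E)=\inf\{\sum_i\nu(B(x_i,r)):(B(x_i,r))_i\text{ is a centered covering of }E\}$, $\mathsf{L}^{1,0}_\nu(E)=\liminf_{r\to0}N^1_{\nu,r}(E)$, $\overline{\mathsf{H}}^{1,0}_\nu(E)=\sup_{F\subseteq E}\mathsf{L}^{1,0}_\nu(F)$, and $\pi(E)=\mathsf{H}^{1,0}_\nu(E)=\inf\{\sum_i\overline{\mathsf{H}}^{1,0}_\nu(E_i):E\subseteq\bigcup_iE_i\}$ (countable covers). For $g:E\to[-\infty,+\infty]$, $\operatorname{ess\,sup}_{x\in E}g(x)=\inf\{c:\pi(\{x\in E:g(x)>c\})=0\}$. Local dimensions: $\underline{\alpha}_\nu(x)=\liminf_{r\to0}\frac{\log\nu(B(x,r))}{\log r}$, $\overline{\alpha}_\nu(x)=\limsup_{r\to0}\frac{\log\nu(B(x,r))}{\log r}$. *)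

(* Defs.v *)
(* R^n is represented by row vectors over an arbitrary realType R. *)
From HB Require Import structures.
From mathcomp Require Import all_boot all_order all_algebra.
From mathcomp Require Import all_classical all_reals all_analysis.
Set Implicit Arguments.
Unset Strict Implicit.
Unset Printing Implicit Defensive.
Import Order.TTheory GRing.Theory Num.Theory.
Import numFieldNormedType.Exports.
Local Open Scope classical_set_scope.
Local Open Scope ring_scope.
Local Open Scope ereal_scope.

(* The topology of 'rV[R]_n is that of the sup norm, which is the usual one. *)
Notation borel_space R n := (g_sigma_algebraType (@open 'rV[R]_n)).

Section EuclideanBalls.
Context {R : realType} {n : nat}.
Implicit Types (x y : 'rV[R]_n) (r : R) (E C : set 'rV[R]_n).

Definition enorm x : R := Num.sqrt (\sum_(i < n) (x ord0 i) ^+ 2)%R.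

(* The library's [ball] on 'rV[R]_n is a cube; the balls here are Euclidean. *)
Definition eball x r : set 'rV[R]_n := [set y | (enorm (y - x) < r)%R].

(* A family of balls of common radius r is given by its set of centers. *)
Definition centered_covering E r C : Prop :=
  C `<=` E /\ E `<=` \bigcup_(x in C) eball x r.

Definition centered_packing E r C : Prop :=
  C `<=` E /\ trivIset C (fun x => eball x r).

End EuclideanBalls.

Section CoveringConstructions.
Context {R : realType} {n : nat}.
Implicit Types (m : set 'rV[R]_n -> \bar R) (E : set 'rV[R]_n).

Definition sup_subsets m E : \bar R := 
  ereal_sup [set m F | F in [set F | F `<=` E]].

(* Finite covers are included by padding with the empty set, at which every
   set function used below vanishes. *)
Definition inf_countable_covers m E : \bar R :=
  ereal_inf [set \sum_(i <oo) m (F i) |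
             F in [set F : nat -> set 'rV[R]_n | E `<=` \bigcup_i F i]].

End CoveringConstructions.

Section HewittStromberg.
Context {R : realType} {n : nat}.
Implicit Types (r t : R) (E : set 'rV[R]_n).

Definition covering_number r E : \bar R :=
  ereal_inf [set counting C | C in centered_covering E r].

Definition packing_number r E : \bar R :=
  ereal_sup [set counting C | C in centered_packing E r].

Definition HS_L t E : \bar R :=
  limf_einf (fun r => covering_number r E * ((2 * r) `^ t)%:E) 0^'+.

Definition HS_Hbar t E : \bar R := sup_subsets (HS_L t) E.

Definition HS_Pbar t E : \bar R :=
  limf_esup (fun r => packing_number r E * ((2 * r) `^ t)%:E) 0^'+.

Definition HS_H t E : \bar R := inf_countable_covers (HS_Hbar t) E.

Definition HS_P t E : \bar R := inf_countable_covers (HS_Pbar t) E.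

Definition lower_dim_MB E : \bar R :=
  ereal_inf [set t%:E | t in [set t | (0 <= t)%R /\ HS_H t E = 0]].

Definition upper_dim_MB E : \bar R :=
  ereal_inf [set t%:E | t in [set t | (0 <= t)%R /\ HS_P t E = 0]].

End HewittStromberg.

Section MeasureDependent.
Context {R : realType} {n : nat}.
Variable nu : probability (borel_space R n) R.
Implicit Types (r : R) (x : 'rV[R]_n) (E : set 'rV[R]_n).

Definition supp : set 'rV[R]_n :=
  [set x | forall U : set 'rV[R]_n, open U -> U x -> 0 < nu U].

Definition covering_mass r E : \bar R :=
  ereal_inf [set \esum_(x in C) nu (eball x r) | C in centered_covering E r].

Definition L10 E : \bar R := limf_einf (fun r => covering_mass r E) 0^'+.

Definition H10bar E : \bar R := sup_subsets L10 E.

(* For E `<=` supp, it is immaterial whether the covering sets are required to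
   lie in supp: H10bar is monotone, so they can be intersected with E. *)
Definition H10 E : \bar R := inf_countable_covers H10bar E.

(* lne 0 = -oo, so the quotient is +oo for a null ball of radius r < 1. *)
Definition log_ratio x r : \bar R := lne (nu (eball x r)) / (ln r)%:E.

Definition lower_local_dim x : \bar R := limf_einf (log_ratio x) 0^'+.

Definition upper_local_dim x : \bar R := limf_esup (log_ratio x) 0^'+.

End MeasureDependent.

(* The library's [ess_sup] needs a measure on a measurable space, whereas p is
   here an outer measure evaluated at arbitrary subsets of E. *)
Definition ess_sup_on {R : realType} {n : nat} (p : set 'rV[R]_n -> \bar R)
    (E : set 'rV[R]_n) (g : 'rV[R]_n -> \bar R) : \bar R :=
  ereal_inf [set c | p [set x | E x /\ c < g x] = 0].

(* Main.v *)
Require Import Defs.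
From mathcomp Require Import all_boot all_order all_algebra.
From mathcomp Require Import all_classical all_reals all_analysis.
From mathcomp Require Import finmap lra ring zify.
Set Implicit Arguments.
Unset Strict Implicit.
Unset Printing Implicit Defensive.
Import Order.TTheory GRing.Theory Num.Theory.
Import numFieldNormedType.Exports.
Local Open Scope classical_set_scope.
Local Open Scope ring_scope.
Local Open Scope ereal_scope.

(** Both inequalities reduce to one kind of claim, with [pi] standing for
    [H10 nu]: if the Hewitt-Stromberg measure of exponent [t] kills [E],
    then the set of points of [E] with local dimension above [t] (above [s]
    for every [s > t], in the upper case) is [pi]-null, so that [t] (each
    such [s]) is one of the numbers over which the essential supremum is an
    infimum. Countable subadditivity of [pi] allows splitting these sets
    freely.

    Lower dimension ([H10_lower_eq0]). If the lower local dimension at [x]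
    exceeds [t], then [nu (B(x,r)) <= r^t] for all small [r]. On the part
    [A_k] where this holds for all [r < 1/(k+1)], a centered covering by [N]
    balls of radius [r] has mass at most [N r^t <= N (2r)^t]; hence the
    premeasure defining [pi] is dominated by the one defining [HS_H t] on
    subsets of [A_k].

    Upper dimension ([H10_upper_eq0]). Here [nu (B(x,r)) <= r^s] is known
    only along radii [r -> 0] that depend on [x], whereas [pi] is built from
    coverings by balls of equal radius, so coverings cannot be compared
    directly. The detour is through [nu] itself, in two steps.

    First, a Borel-Cantelli argument ([exists_small_open_upper]). On a piece
    [F] where the packing premeasure of exponent [t] is finite, the packing
    number at scale [r] is [O(r^-t)]. Rounding radii to powers of 1/2, the
    points whose ball at scale [2^-k] is light are covered by [O(2^(kt))]
    balls of mass [O(2^(-ks))], and [2^(-k(s-t))] is summable. So the set of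
    points in question lies in open sets of arbitrarily small [nu]-measure.

    Second, [pi] is at most a constant times [nu] on open sets
    ([H10_le_open]), so such a set is [pi]-null. For one radius, a covering
    by boundedly many packings ([cover_by_packings]) has mass at most a
    constant times the mass of the union of its balls. To obtain a bound
    valid for all small radii at once, the open set is cut into countably
    many layers according to the distance to its complement; small balls
    centered in a layer remain in the neighbouring layers, and these
    neighbourhoods overlap at most three times. *)

(** * Lower and upper limits along a filter *)

Section LimitsAlongFilters.
Context {R : realType} {F : set_system R}.
Implicit Types (f g : R -> \bar R) (c : \bar R).

Lemma le_limf_einf f g :
  Filter F -> (\forall x \near F, f x <= g x) -> limf_einf f F <= limf_einf g F.
Proof.
move=> FF fg; rewrite !limf_einfE; apply: ge_ereal_sup => _ [V FV <-].
apply: le_ereal_sup_tmp; eexists; first by exists (V `&` [set x | f x <= g x]);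
  [exact: filterI|reflexivity].
apply: le_ereal_inf_tmp => _ [x [Vx /= fgx] <-]; apply: le_trans fgx.
by apply: ereal_inf_lbound; exists x.
Qed.

Lemma limf_einf_le_cst f c :
  ProperFilter F -> (\forall x \near F, f x <= c) -> limf_einf f F <= c.
Proof.
move=> FF fc; rewrite limf_einfE; apply: ge_ereal_sup => _ [V FV <-].
have /filter_ex[x [Vx /= fcx]] : F (V `&` [set x | f x <= c]) by exact: filterI.
by apply: le_trans fcx; apply: ereal_inf_lbound; exists x.
Qed.

Lemma limf_einf_ge0 f : Filter F -> (forall x, 0 <= f x) -> 0 <= limf_einf f F.
Proof.
move=> FF f0; rewrite limf_einfE; apply: le_ereal_sup_tmp; eexists.
  by exists setT; [exact: filterT|reflexivity].
by apply: le_ereal_inf_tmp => _ [x _ <-].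
Qed.

Lemma near_lt_limf_einf f c :
  Filter F -> c < limf_einf f F -> \forall x \near F, c < f x.
Proof.
move=> FF; rewrite limf_einfE => /ereal_sup_gt[_ [V FV <-] cV].
apply: filterS FV => x Vx; apply: lt_le_trans cV _.
by apply: ereal_inf_lbound; exists x.
Qed.

Lemma near_limf_esup_lt f c :
  Filter F -> limf_esup f F < c -> \forall x \near F, f x < c.
Proof.
move=> FF; rewrite limf_esupE => /ereal_inf_lt[_ [V FV <-] cV].
apply: filterS FV => x Vx; apply: le_lt_trans cV.
by apply: ereal_sup_ubound; exists x.
Qed.

Lemma frequently_lt_limf_esup f c (V : set R) :
  F V -> c < limf_esup f F -> exists2 x, V x & c < f x.
Proof.
move=> FV; rewrite limf_esupE => cf.
have : c < ereal_sup (f @` V).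
  by apply: lt_le_trans cf _; apply: ereal_inf_lbound; exists V.
by case/ereal_sup_gt => _ [x Vx <-] cfx; exists x.
Qed.

End LimitsAlongFilters.

(** * Small radii and powers of 1/2 *)

Section SmallRadii.
Context {R : realType}.
Implicit Types (r e : R).

Lemma near0_lt e : (0 < e)%R -> \forall r \near (0%R : R)^'+, (0 < r < e)%R.
Proof.
move=> e0; near=> r; apply/andP; split; first by near: r; exact: nbhs_right_gt.
by near: r; exact: nbhs_right_lt.
Unshelve. all: by end_near. Qed.

Lemma near0_rightP (P : set R) : (\forall r \near 0%R^'+, P r) ->
  exists2 e : R, (0 < e)%R & forall r, (0 < r < e)%R -> P r.
Proof.
move=> /nbhs_ballP[e /= e0 eP]; exists e => // r /andP[r0 re].
by apply: eP => //=; rewrite /ball/= sub0r normrN gtr0_norm.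
Qed.

Definition dyadic (k : nat) : R := (2^-1 ^+ k)%R.

Lemma dyadic_gt0 k : (0 < dyadic k)%R.
Proof. by rewrite exprn_gt0. Qed.

Lemma dyadicS k : dyadic k = (2 * dyadic k.+1)%R.
Proof. by rewrite /dyadic exprS mulrA divff// mul1r. Qed.

Lemma le_dyadic i j : (i <= j)%N -> (dyadic j <= dyadic i)%R.
Proof. by apply: ler_wiXn2l; lra. Qed.

Lemma near_dyadic_lt e : (0 < e)%R -> \forall k \near \oo, (dyadic k < e)%R.
Proof.
move=> e0; have : dyadic k @[k --> \oo] --> (0 : R)%R.
  by apply: cvg_expr; rewrite ger0_norm; lra.
move=> /cvgrPdist_lt/(_ _ e0); apply: filterS => k.
by rewrite sub0r normrN gtr0_norm// dyadic_gt0.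
Qed.

Lemma exists_dyadic_scale r k0 : (0 < r < dyadic k0)%R ->
  exists2 k, (k0 <= k)%N & (dyadic k <= r < 2 * dyadic k)%R.
Proof.
move=> /andP[r0 rk0].
have ex : exists k, (dyadic k <= r)%R.
  by have [k /ltW] := filter_ex (near_dyadic_lt r0); exists k.
case: (ex_minnP ex) => k kr mink.
have kk0 : (k0 < k)%N.
  by rewrite ltnNge; apply/negP => /le_dyadic; lra.
exists k; rewrite ?(ltnW kk0)// kr/=.
case: k => // k in kr mink kk0 *.
rewrite -dyadicS ltNge; apply/negP => rk.
suff : (k.+1 <= k)%N by rewrite ltnn.
exact: mink.
Qed.

Lemma powR_dyadic u k :
  ((2 * dyadic k) `^ u = 2 `^ u * (2^-1 `^ u) ^+ k)%R.
Proof.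
rewrite powRM ?(ltW (dyadic_gt0 k))//; congr (_ * _)%R.
by rewrite /dyadic -powR_mulrn// powRAC powR_mulrn// powR_ge0.
Qed.

Lemma sum_geometric_le (q : R) m : (0 <= q < 1)%R ->
  (\sum_(0 <= j < m) q ^+ j <= (1 - q)^-1)%R.
Proof.
move=> /andP[q0 q1]; have q1' : (0 < 1 - q)%R by lra.
rewrite -[leRHS]mul1r ler_pdivlMr//.
have -> : ((\sum_(0 <= j < m) q ^+ j) * (1 - q) = 1 - q ^+ m)%R.
  elim: m => [|m IH]; first by rewrite big_geq// mul0r expr0 subrr.
  by rewrite big_nat_recr//= mulrDl IH exprS; ring.
by rewrite lerBlDr lerDl exprn_ge0.
Qed.

End SmallRadii.

(** * Set functions obtained from countable covers *)

Section CountableCovers.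
Context {R : realType} {n : nat}.
Implicit Types (m : set 'rV[R]_n -> \bar R) (A B : set 'rV[R]_n).

(** The outer measure extending a set function is formed from covers by
    measurable sets.  Over the sigma-algebra of all sets this restriction is
    void, which gives access to the subadditivity of such extensions. *)
Lemma inf_countable_covers_mu_ext m A :
  inf_countable_covers m A =
  mu_ext (m : set (g_sigma_algebraType [set: set 'rV[R]_n]) -> \bar R) A.
Proof.
rewrite /inf_countable_covers /mu_ext; congr (ereal_inf (_ @` _)).
apply/seteqP; split => [G AG|G []//]; split => // i.
exact: sub_sigma_algebra.
Qed.

Lemma inf_countable_covers_le_sum m A (G : nat -> set 'rV[R]_n) :
  A `<=` \bigcup_i G i -> inf_countable_covers m A <= \sum_(i <oo) m (G i).
Proof. by move=> AG; apply: ereal_inf_lbound; exists G. Qed.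

Lemma inf_countable_covers_le m A B :
  A `<=` B -> inf_countable_covers m A <= inf_countable_covers m B.
Proof. by rewrite !inf_countable_covers_mu_ext => AB; exact: le_mu_ext. Qed.

Lemma inf_countable_covers_eq0_bigcup m A (G : nat -> set 'rV[R]_n) :
  (forall B, 0 <= m B) -> A `<=` \bigcup_i G i ->
  (forall i, inf_countable_covers m (G i) = 0) -> inf_countable_covers m A = 0.
Proof.
move=> m0 AG G0; apply/eqP; rewrite eq_le; apply/andP; split; last first.
  by rewrite inf_countable_covers_mu_ext; exact: mu_ext_ge0.
apply: le_trans (inf_countable_covers_le m AG) _.
rewrite inf_countable_covers_mu_ext.
have := mu_ext_sigma_subadditive
  (m0 : forall B : set (g_sigma_algebraType [set: set 'rV[R]_n]), 0 <= m B) G.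
move/le_trans; apply.
by rewrite eseries0// => i _ _; rewrite -inf_countable_covers_mu_ext.
Qed.

Lemma inf_countable_covers_ge0 m A :
  (forall B, 0 <= m B) -> 0 <= inf_countable_covers m A.
Proof.
by move=> m0; rewrite inf_countable_covers_mu_ext; exact: mu_ext_ge0.
Qed.

Lemma inf_countable_covers_eq0_cover m A (e : R) :
  inf_countable_covers m A = 0 -> (0 < e)%R ->
  exists2 G : nat -> set 'rV[R]_n, A `<=` \bigcup_i G i &
    \sum_(i <oo) m (G i) < e%:E.
Proof.
move=> A0 e0; have : inf_countable_covers m A < e%:E by rewrite A0 lte_fin.
by case/ereal_inf_lt => _ [G AG <-]; exists G.
Qed.

Lemma sup_subsets_ge m A B : B `<=` A -> m B <= sup_subsets m A.
Proof. by move=> BA; apply: ereal_sup_ubound; exists B. Qed.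

Lemma sup_subsets_ge0 m A : (forall B, 0 <= m B) -> 0 <= sup_subsets m A.
Proof. by move=> m0; exact: le_trans (m0 A) (sup_subsets_ge _ _). Qed.

End CountableCovers.

(** * Euclidean balls and the coordinates of their points *)

Section EuclideanBallsByCoordinates.
Context {R : realType} {n : nat}.
Implicit Types (x y : 'rV[R]_n) (r : R).

Lemma eball_coord x y r i : eball x r y -> (`|y ord0 i - x ord0 i| < r)%R.
Proof.
apply: le_lt_trans; rewrite -sqrtr_sqr ler_sqrt; last first.
  by apply: sumr_ge0 => j _; exact: sqr_ge0.
rewrite (bigD1 i)//= !mxE lerDl; apply: sumr_ge0 => j _; exact: sqr_ge0.
Qed.

(** The divisor [n + 1], larger than the square root of [n] that the estimate
    requires, is also meaningful in dimension 0. *)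
Lemma coord_eball x y r : (0 < r)%R ->
  (forall i, `|y ord0 i - x ord0 i| <= r / n.+1%:R)%R -> eball x r y.
Proof.
move=> r0 xy; rewrite /eball/= /enorm -[ltRHS]gtr0_norm// -sqrtr_sqr.
rewrite ltr_sqrt ?exprn_gt0//.
apply: (@le_lt_trans _ _ (\sum_(i < n) (r / n.+1%:R) ^+ 2)%R).
  apply: ler_sum => i _; rewrite !mxE -real_normK ?num_real//.
  by apply: lerXn2r; rewrite ?nnegrE ?xy ?divr_ge0 ?(ltW r0).
rewrite sumr_const card_ord -[ltLHS]mulr_natr exprMn -mulrA.
rewrite gtr_pMr ?exprn_gt0// exprVn mulrC ltr_pdivrMr ?exprn_gt0// mul1r.
by rewrite -natrX ltr_nat; nia.
Qed.

Lemma eball_sub_ball x r : eball x r `<=` ball x r.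
Proof.
move=> y xry; split; first exact: le_lt_trans (sqrtr_ge0 _) xry.
by move=> i j; rewrite ord1 /ball/= distrC; exact: eball_coord.
Qed.

Lemma le_eball x r r' : (r <= r')%R -> eball x r `<=` eball x r'.
Proof. by move=> rr' y /= /lt_le_trans; apply. Qed.

Lemma open_eball x r : open (eball x r).
Proof.
have coord i : continuous (fun y : 'rV[R]_n => ((y - x) ord0 i) ^+ 2)%R.
  rewrite (_ : (fun y => _) =
      (fun t => t ^+ 2)%R \o (fun y : 'rV[R]_n => y ord0 i - x ord0 i)%R).
    move=> y; apply: continuous_comp; last exact: exprn_continuous.
    apply: continuousB; last exact: cst_continuous.
    exact: coord_continuous.
  by apply/funext => y /=; rewrite !mxE.
have cont : continuous (fun y : 'rV[R]_n => enorm (y - x)).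
  move=> y; apply: (@continuous_comp _ _ _
    (fun y : 'rV[R]_n => \sum_(i < n) ((y - x) ord0 i) ^+ 2)%R Num.sqrt);
    last exact: sqrt_continuous.
  apply: (@cvg_big _ _ _ _ _ _ _ (nbhs y) _
    (fun i (z : 'rV[R]_n) => ((z - x) ord0 i) ^+ 2)%R) => [|i _].
    exact: add_continuous.
  exact: coord.
exact: (open_comp (fun y _ => cont y) (@open_lt _ r)).
Qed.

End EuclideanBallsByCoordinates.

(** * Covering a set by boundedly many packings *)

(** Colours of the cells of a cubic grid of side [r / (n + 1)], namely the
    indices of a cell modulo [2n + 3]. The side is small enough for a cell
    to lie in the [r]-ball around any of its points; the modulus is large
    enough for distinct cells of equal colour to differ by at least [2n + 3]
    in some index, so that their points are more than [2r] apart in some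
    coordinate. *)
Definition grid_colour n : finType := {ffun 'I_n -> 'I_(n.*2.+3)}.

Section Grid.
Context {R : realType} {n : nat} (r : R).
Hypothesis r_gt0 : (0 < r)%R.
Implicit Types (x y : 'rV[R]_n) (F : set 'rV[R]_n).

Definition grid_cell x : {ffun 'I_n -> int} :=
  [ffun i => Num.floor (x ord0 i / (r / n.+1%:R))].

Definition cell_colour (z : {ffun 'I_n -> int}) : grid_colour n :=
  [ffun i => inord `|(z i %% n.*2.+3)%Z|%N].

Lemma same_cell_eball x y : grid_cell x = grid_cell y -> eball x r y.
Proof.
have d0 : (0 < r / n.+1%:R)%R by rewrite divr_gt0.
move=> xy; apply: coord_eball => // i.
have /(congr1 (fun f : {ffun _} => f i)) := xy; rewrite !ffunE => fxy.
have /andP[] := floor_itv (x ord0 i / (r / n.+1%:R)).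
have /andP[] := floor_itv (y ord0 i / (r / n.+1%:R)).
rewrite -fxy; set f := Num.floor _; rewrite intrD/= => y1 y2 x1 x2.
have : (`|y ord0 i / (r / n.+1%:R) - x ord0 i / (r / n.+1%:R)| <= 1)%R.
  by rewrite ler_norml; lra.
by rewrite -mulrBl normrM normfV (gtr0_norm d0) ler_pdivrMr// mul1r.
Qed.

Lemma same_colour_disjoint x y :
  cell_colour (grid_cell x) = cell_colour (grid_cell y) ->
  eball x r `&` eball y r !=set0 -> grid_cell x = grid_cell y.
Proof.
have d0 : (0 < r / n.+1%:R)%R by rewrite divr_gt0.
move=> cxy [z [xz yz]]; apply/ffunP => i.
have := congr1 (fun f : grid_colour n => f i : nat) cxy; rewrite !ffunE.
set a := Num.floor _; set b := Num.floor _ => ab.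
have /andP[x1 x2] : (a%:~R <= x ord0 i / (r / n.+1%:R) < (a + 1)%:~R)%R.
  exact: floor_itv.
have /andP[y1 y2] : (b%:~R <= y ord0 i / (r / n.+1%:R) < (b + 1)%:~R)%R.
  exact: floor_itv.
(* A common point is within r of both centers in each coordinate, and r is
   n + 1 sides of a cell. *)
have xy : (`|x ord0 i / (r / n.+1%:R) - y ord0 i / (r / n.+1%:R)|
    < n.+1.*2%:R)%R.
  rewrite -mulrBl normrM normfV (gtr0_norm d0) ltr_pdivrMr//.
  rewrite -muln2 natrM mulrAC mulrCA divff// mulr1.
  have := eball_coord i xz; have := eball_coord i yz.
  rewrite !ltr_norml; lra.
have {xy} abn : (`|a - b| < n.*2.+3%:Z)%R.
  rewrite -(ltr_int R) intr_norm intrB.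
  move: xy x1 x2 y1 y2; rewrite !intrD ltr_norml.
  rewrite -!pmulrn (_ : n.*2.+3%:R = n.+1.*2%:R + 1 :> R)%R; last first.
    by rewrite -natr1.
  rewrite ltr_norml; lra.
(* Congruent indices at distance less than the modulus are equal. *)
move: ab abn.
have H (c : int) : (inord `|(c %% n.*2.+3)%Z|%N : 'I_(n.*2.+3)) =
    `|(c %% n.*2.+3)%Z|%N :> nat.
  by rewrite inordK//; have := ltz_mod c (isT : n.*2.+3%:Z != 0%R); lia.
rewrite !H => ab abn.
have {}ab : (a = b %[mod n.*2.+3])%Z.
  have := modz_ge0 a (isT : n.*2.+3%:Z != 0%R).
  have := modz_ge0 b (isT : n.*2.+3%:Z != 0%R).
  by move: ab; set u := modz _ _; set v := modz _ _; lia.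
have : (n.*2.+3 %| (a - b)%R)%Z by rewrite -eqz_mod_dvd; exact/eqP.
rewrite dvdzE => /dvdnP[k].
case: k => [|k]; first by move: abn => _; lia.
by rewrite mulSn; lia.
Qed.

(** Choosing one point of [F] in every cell that meets [F] covers [F]; the
    chosen points in cells of a given colour form a packing.  The number of
    packings depends on the dimension only. *)
Lemma cover_by_packings F : exists C : grid_colour n -> set 'rV[R]_n,
  (forall c, centered_packing F r (C c)) /\
  F `<=` \bigcup_(c in setT) \bigcup_(x in C c) eball x r.
Proof.
(* The representative depends on x only through its cell. *)
pose rep x := get [set y | F y /\ grid_cell y = grid_cell x].
have repP x : F x -> F (rep x) /\ grid_cell (rep x) = grid_cell x.
  by move=> Fx; apply: (@getPex _ [set y | F y /\ _]); exists x.
exists (fun c => rep @` (F `&` [set x | cell_colour (grid_cell x) = c])).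
split => [c|x Fx].
  split => [_ [x [Fx _] <-]|]; first exact: (repP x Fx).1.
  move=> _ _ [x [Fx xc] <-] [y [Fy yc] <-] xy.
  suff xy' : grid_cell x = grid_cell y by rewrite /rep xy'.
  have [[_ rx] [_ ry]] := (repP x Fx, repP y Fy); rewrite -rx -ry.
  by apply: same_colour_disjoint => //; rewrite rx ry xc.
exists (cell_colour (grid_cell x)) => //; exists (rep x).
  by exists x.
exact/same_cell_eball/(repP x Fx).2.
Qed.

End Grid.

(** * Sums over finite and infinite families *)

Section SumsAndCardinality.
Context {R : realType} {T : choiceType}.
Implicit Types (C D : set T) (f : T -> \bar R).

Lemma counting_ge0 C : 0 <= counting C :> \bar R.
Proof. by rewrite /counting; case: ifPn; rewrite ?lee_fin// leey. Qed.

Lemma counting_esum C : counting C = \esum_(x in C) 1 :> \bar R.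
Proof.
rewrite /counting; case: ifPn => /asboolP finC.
  rewrite esum_fset// fsbig_finite//= sumEFin big_const_seq count_predT.
  by rewrite iter_addr_0.
apply/esym/eqyP => A A0; apply: esum_ge.
have [D DC leD] := infinite_set_fset (Num.truncn A).+1 finC.
eexists; first by split; [exact: finite_fset|exact: DC].
rewrite fsbig_finite//= sumEFin lee_fin set_fsetK big_const_seq count_predT.
rewrite iter_addr_0 ltW//; apply: lt_le_trans (truncnS_gt A) _.
by rewrite ler_nat.
Qed.

Lemma esum_le_counting C f (a : R) : (0 < a)%R ->
  (forall x, C x -> f x <= a%:E) -> \esum_(x in C) f x <= counting C * a%:E.
Proof.
move=> a0 fa; rewrite /counting; case: ifPn => /asboolP finC; last first.
  by rewrite gt0_mulye ?lte_fin// leey.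
apply: ge_ereal_sup => _ [D [finD DC] <-].
apply: (@le_trans _ _ (\sum_(x \in D) a%:E)).
  by apply: lee_fsum => // x /DC/fa.
rewrite fsbig_finite//= sumEFin big_const_seq count_predT iter_addr_0.
rewrite -EFinM lee_fin mulr_natl ler_pMn2l// uniq_leq_size// => x.
by rewrite !in_fset_set// => /set_mem/DC; exact: mem_set.
Qed.

Lemma esum_bigcup_fin_le (I : finType) (C : I -> set T) f (b : \bar R) :
  (forall x, 0 <= f x) -> (forall i, \esum_(x in C i) f x <= b) ->
  \esum_(x in \bigcup_i C i) f x <= #|I|%:R%:E * b.
Proof.
move=> f0 fb; set U := \bigcup_i C i.
apply: (@le_trans _ _
  (\esum_(x in U) \sum_(i : I) if x \in C i then f x else 0)).
  apply: le_esum => x [i _ Cix]; rewrite (bigD1 i)//= mem_set// leeDl//.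
  by apply: sume_ge0 => j _; case: ifP.
rewrite esum_sum; last by move=> x i _ _; case: ifP.
apply: (@le_trans _ _ (\sum_(i : I) b)).
  apply: lee_sum => i _; rewrite -esum_mkcondr.
  apply: le_trans (fb i); rewrite setIC esum_mkcondr; apply: le_esum => x _.
  by case: ifP.
by rewrite sumr_const mule_natl.
Qed.

End SumsAndCardinality.

(** * Covering numbers, packing numbers and masses of coverings *)

Section CoveringByPackings.
Context {R : realType} {n : nat}.
Implicit Types (r : R) (F : set 'rV[R]_n).

(** The sum of [f] over the centers is quantified inside, for one covering, so
    that the same statement bounds both the number of balls ([f = 1]) and
    their total mass ([f x = nu (eball x r)]). *)
Lemma exists_covering_by_packings r F : (0 < r)%R ->
  exists2 C, centered_covering F r C &
    forall (f : 'rV[R]_n -> \bar R) (b : \bar R), (forall x, 0 <= f x) ->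
      (forall P, centered_packing F r P -> \esum_(x in P) f x <= b) ->
      \esum_(x in C) f x <= #|grid_colour n|%:R%:E * b.
Proof.
move=> r0; have [P [packP coverP]] := cover_by_packings r0 F.
exists (\bigcup_c P c); first split.
- by move=> x [c _ Pcx]; exact: (packP c).1.
- by move=> x /coverP[c _ [y Pcy xy]]; exists y => //; exists c.
- by move=> f b f0 fb; apply: esum_bigcup_fin_le => // c; exact: fb.
Qed.

Lemma exists_covering_le_packing_number r F : (0 < r)%R ->
  exists2 C, centered_covering F r C &
    counting C <= #|grid_colour n|%:R%:E * packing_number r F.
Proof.
move=> r0; have [C covC leC] := exists_covering_by_packings F r0.
exists C => //; rewrite counting_esum; apply: leC => // P packP.
by rewrite -counting_esum; apply: ereal_sup_ubound; exists P.
Qed.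

Lemma le_packing_number r F G :
  G `<=` F -> packing_number r G <= packing_number r F.
Proof.
move=> GF; apply: ereal_sup_le => _ [P [PG tP] <-]; exists P => //.
by split => //; exact: subset_trans GF.
Qed.

Lemma packing_number_ge0 r F : 0 <= packing_number r F.
Proof.
apply: ereal_sup_ubound; exists set0; first by split => // x y [].
by rewrite /counting asboolT// fset_set0.
Qed.

End CoveringByPackings.

Section MassOfCoverings.
Context {R : realType} {n : nat}.
Variable nu : probability (borel_space R n) R.
Implicit Types (r : R) (F U : set 'rV[R]_n).

Lemma measurable_open U : open U -> measurable (U : set (borel_space R n)).
Proof. exact: sub_sigma_algebra. Qed.

Lemma measurable_eball x r : measurable (eball x r : set (borel_space R n)).
Proof. by apply: measurable_open; exact: open_eball. Qed.

(** Infinite sums are suprema of finite ones, so finite additivity on disjoint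
    balls suffices, whatever the cardinality of the packing. *)
Lemma packing_mass_le r F P U : measurable (U : set (borel_space R n)) ->
  centered_packing F r P -> (forall x, P x -> eball x r `<=` U) ->
  \esum_(x in P) nu (eball x r) <= nu U.
Proof.
move=> mU [PF tP] PU; apply: ge_ereal_sup => _ [D [finD DP] <-].
have mB x : D x -> measurable (eball x r : set (borel_space R n)).
  by move=> _; exact: measurable_eball.
rewrite -(measure_fin_bigcup nu finD _ mB); last exact: sub_trivIset tP.
apply: le_measure; [|exact: mem_set|by apply: bigcup_sub => x /DP/PU].
by apply: mem_set; exact: fin_bigcup_measurable.
Qed.

Lemma covering_mass_le r F U : (0 < r)%R ->
  measurable (U : set (borel_space R n)) ->
  (forall x, F x -> eball x r `<=` U) ->
  covering_mass nu r F <= #|grid_colour n|%:R%:E * nu U.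
Proof.
move=> r0 mU FU; have [C covC leC] := exists_covering_by_packings F r0.
apply: (@le_trans _ _ (\esum_(x in C) nu (eball x r))).
  by apply: ereal_inf_lbound; exists C.
apply: leC => // P packP; apply: (packing_mass_le mU packP) => x /packP.1.
exact: FU.
Qed.

(** This inequality links [pi] to the Hewitt-Stromberg measure: the mass of a
    covering by light balls is controlled by their number. *)
Lemma covering_mass_le_number r F (a : R) : (0 < a)%R ->
  (forall x, F x -> nu (eball x r) <= a%:E) ->
  covering_mass nu r F <= covering_number r F * a%:E.
Proof.
move=> a0 Fa; rewrite -lee_pdivrMr//; apply: le_ereal_inf_tmp => _ [C covC <-].
rewrite lee_pdivrMr//; apply: le_trans (esum_le_counting a0 _).
  by apply: ereal_inf_lbound; exists C.
by move=> x /covC.1/Fa.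
Qed.

Lemma covering_mass_ge0 r F : 0 <= covering_mass nu r F.
Proof. by apply: le_ereal_inf_tmp => _ [C _ <-]; exact: esum_ge0. Qed.

(** One scale of the Borel-Cantelli argument: points with light balls at scale
    [r] have an open neighbourhood whose mass is at most the number of balls
    times the bound on the mass of each. *)
Lemma exists_open_le_packing_number r F (a : R) : (0 < r)%R -> (0 < a)%R ->
  packing_number r F < +oo ->
  (forall x, F x -> nu (eball x r) <= a%:E) ->
  exists U, [/\ open U, F `<=` U &
    nu U <= #|grid_colour n|%:R%:E * packing_number r F * a%:E].
Proof.
move=> r0 a0 Foo Fa.
have [C [CF FC] leC] := exists_covering_le_packing_number F r0.
exists (\bigcup_(x in C) eball x r); split => //.
  by apply: bigcup_open => x _; exact: open_eball.
have finC : finite_set C.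
  apply: contrapT => infC; move: leC; rewrite /counting asboolF// leye_eq.
  apply/negP; rewrite -ltey lte_mul_pinfty//.
apply: le_trans (lee_wpmul2r _ leC); last by rewrite lee_fin ltW.
apply: le_trans (esum_le_counting a0 (fun x Cx => Fa x (CF x Cx))).
rewrite esum_fset//; apply: content_sub_fsum => //.
  by move=> x _; exact: measurable_eball.
by apply: measurable_open; apply: bigcup_open => x _; exact: open_eball.
Qed.

End MassOfCoverings.

(** * Domination of the covering outer measure by the measure on open sets *)

Section OpenNeighbourhoods.
Context {R : realType} {n : nat}.
Variable nu : probability (borel_space R n) R.
Implicit Types (r : R) (X U : set 'rV[R]_n).

Lemma L10_ge0 X : 0 <= L10 nu X.
Proof. by apply: limf_einf_ge0 => r; exact: covering_mass_ge0. Qed.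

Lemma H10bar_ge0 X : 0 <= H10bar nu X.
Proof. by apply: sup_subsets_ge0; exact: L10_ge0. Qed.

Lemma H10bar_le_mass X U (e : R) : (0 < e)%R ->
  measurable (U : set (borel_space R n)) ->
  (forall x, X x -> eball x e `<=` U) ->
  H10bar nu X <= #|grid_colour n|%:R%:E * nu U.
Proof.
move=> e0 mU XU; apply: ge_ereal_sup => _ [F FX <-].
apply: limf_einf_le_cst; apply: filterS (near0_lt e0) => r /andP[r0 re].
apply: covering_mass_le => // x /FX/XU; apply: subset_trans.
exact/le_eball/ltW.
Qed.

(** The points of [U] at distance at least [2^-(j-2)] from the complement.  The
    sequence starts with two empty sets so that the differences of indices 3
    apart below need no special treatment of the first layers.  The sup norm
    serves here, since Euclidean balls are contained in cubes of the same
    radius. *)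
Definition inner_layer U (j : nat) : set 'rV[R]_n :=
  if j is k.+2 then [set y | ball y (dyadic k) `<=` U] else set0.

Lemma measurable_inner_layer U j :
  measurable (inner_layer U j : set (borel_space R n)).
Proof.
case: j => [|[|k]] //=; set e := dyadic k.
rewrite (_ : mkset _ = ~` \bigcup_(z in ~` U) ball z e).
  apply: measurableC; apply: measurable_open; apply: bigcup_open => z _.
  exact: ball_open.
apply/seteqP; split => y /=.
  by move=> yU [z /= nUz zy]; apply: nUz; apply: yU; exact: ball_sym.
move=> yU z yz; apply: contrapT => nUz; apply: yU; exists z => //.
exact: ball_sym.
Qed.

Lemma inner_layer_sub U j : inner_layer U j `<=` U.
Proof.
by case: j => [|[|k]] //= y; apply; apply: ballxx; exact: dyadic_gt0.
Qed.

(** Moving by [2^-j] from a point at distance [2^-(j-2)] from the complement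
    leaves a distance of at least [2^-(j-1)]. *)
Lemma inner_layer_ball U j x y :
  ball x (dyadic j) y -> inner_layer U j x -> inner_layer U j.+1 y.
Proof.
case: j => [|[|k]] //= xy xU z yz; apply: xU.
have := ball_triangle xy yz; apply: le_ball.
by have := @dyadic_gt0 R k.+2; rewrite (dyadicS k) (dyadicS k.+1); lra.
Qed.

Lemma inner_layerS U j : inner_layer U j `<=` inner_layer U j.+1.
Proof.
by move=> x; apply: inner_layer_ball; apply: ballxx; exact: dyadic_gt0.
Qed.

Lemma inner_layer_cover U : open U ->
  U `<=` \bigcup_j (inner_layer U j.+2 `\` inner_layer U j.+1).
Proof.
move=> oU x Ux.
have ex : exists j, `[< inner_layer U j x >].
  have /nbhs_ballP[e /= e0 xeU] : nbhs x U by exact: open_nbhs_nbhs.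
  have [k ke] := filter_ex (near_dyadic_lt e0).
  exists k.+2; apply/asboolP => /=; apply: subset_trans xeU.
  exact/le_ball/ltW.
case: (ex_minnP ex) => -[|[|j]] /asboolP // Uj minj.
exists j => //; split => // Uj1.
by have := minj j.+1 (asboolT Uj1); rewrite ltnn.
Qed.

(** The sum telescopes to three final terms minus three initial ones: each
    point of [U] is counted at most three times. *)
Lemma sum_inner_layer_le U m : measurable (U : set (borel_space R n)) ->
  \sum_(0 <= j < m) nu (inner_layer U j.+3 `\` inner_layer U j) <= 3%:E * nu U.
Proof.
move=> mU; pose a j := fine (nu (inner_layer U j)).
have ja i : nu (inner_layer U i) = (a i)%:E.
  by rewrite fineK// fin_num_measure//; exact: measurable_inner_layer.
have fU : nu U = (fine (nu U))%:E by rewrite fineK// fin_num_measure.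
have a0 i : (0 <= a i)%R by rewrite fine_ge0.
have aU i : (a i <= fine (nu U))%R.
  rewrite -lee_fin -ja -fU; apply: le_measure; [| |exact: inner_layer_sub].
    by apply: mem_set; exact: measurable_inner_layer.
  exact: mem_set.
have shell j : nu (inner_layer U j.+3 `\` inner_layer U j) = (a j.+3 - a j)%:E.
  rewrite measureD; [|exact: measurable_inner_layer..|].
    rewrite setIidr; last by do 3!apply: subset_trans (@inner_layerS _ _).
    by rewrite EFinB -!ja.
  by rewrite ltey_eq fin_num_measure//; exact: measurable_inner_layer.
under eq_bigr do rewrite shell.
rewrite sumEFin fU -EFinM lee_fin.
have -> : (\sum_(0 <= j < m) (a j.+3 - a j) =
           a m + a m.+1 + a m.+2 - (a 0 + a 1 + a 2))%R.
  elim: m => [|m IH]; first by rewrite big_geq// subrr.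
  rewrite big_nat_recr//= IH; ring.
have := (aU m, aU m.+1, aU m.+2); have := (a0 0%N, a0 1%N, a0 2%N).
by move=> [[? ?] ?] [[? ?] ?]; lra.
Qed.

(** On one layer, the mass of coverings by balls of any sufficiently small
    radius is bounded by the measure of the adjacent layers; how small depends
    on the layer, which the countable covers in the definition of [H10]
    permit. *)
Lemma H10_le_open X U : open U -> X `<=` U ->
  H10 nu X <= #|grid_colour n|%:R%:E * (3%:E * nu U).
Proof.
move=> oU XU; have mU := measurable_open oU.
pose D j := inner_layer U j.+2 `\` inner_layer U j.+1.
pose S j := inner_layer U j.+3 `\` inner_layer U j.
have mS j : measurable (S j : set (borel_space R n)).
  by apply: measurableD; exact: measurable_inner_layer.
apply: (@le_trans _ _ (\sum_(j <oo) H10bar nu (X `&` D j))).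
  apply: inf_countable_covers_le_sum => x Xx.
  by have [j _ Dx] := inner_layer_cover oU (XU x Xx); exists j.
apply: (@le_trans _ _ (\sum_(j <oo) #|grid_colour n|%:R%:E * nu (S j))).
  apply: lee_nneseries => [j _ _|j _]; first exact: H10bar_ge0.
  apply: (H10bar_le_mass (dyadic_gt0 j.+2)) => // x [_ [x2 x1]] y xy.
  have /eball_sub_ball xy' := xy.
  split; first exact: inner_layer_ball x2.
  move=> yj; apply: x1; apply: inner_layer_ball yj; apply: ball_sym.
  by apply: le_ball xy'; apply: le_dyadic; rewrite leqW.
rewrite nneseriesZl//; apply: lee_wpmul2l => //.
apply: lime_le; first exact: is_cvg_nneseries.
by apply: nearW => m; exact: sum_inner_layer_le.
Qed.

Lemma H10_eq0_open X :
  (forall e : R, (0 < e)%R -> exists U, [/\ open U, X `<=` U & nu U <= e%:E]) ->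
  H10 nu X = 0.
Proof.
move=> Xe; apply/eqP; rewrite eq_le inf_countable_covers_ge0 ?andbT; last first.
  exact: H10bar_ge0.
apply/lee_addgt0Pr => e e0; rewrite add0e.
pose N : R := (#|grid_colour n|.+1%:R * 3)%R.
have N0 : (0 < N)%R by rewrite mulr_gt0.
have [U [oU XU Ue]] := Xe (e / N)%R (divr_gt0 e0 N0).
apply: le_trans (H10_le_open oU XU) _.
apply: (@le_trans _ _ (N%:E * nu U)).
  rewrite muleA -EFinM; apply: lee_wpmul2r => //.
  by rewrite lee_fin ler_pM2r// ler_nat.
apply: le_trans (lee_wpmul2l _ Ue) _; first by rewrite lee_fin ltW.
by rewrite -EFinM lee_fin mulrC divfK// gt_eqF.
Qed.

End OpenNeighbourhoods.

(** * Null sets of points of large local dimension *)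

Section LocalDimensions.
Context {R : realType} {n : nat}.
Variable nu : probability (borel_space R n) R.
Implicit Types (r s t : R) (x : 'rV[R]_n) (E F X : set 'rV[R]_n).

Lemma eball_mass_le_powR x r s : (0 < r < 1)%R ->
  s%:E < log_ratio nu x r -> nu (eball x r) <= (r `^ s)%:E.
Proof.
move=> r01; have lnr := ln_lt0 r01; have /andP[r0 r1] := r01.
have mB := measurable_eball x r.
rewrite /log_ratio -(fineK (fin_num_measure nu _ mB)).
set q := fine _; have q0 : (0 <= q)%R by exact: fine_ge0.
rewrite inver lt_eqF// lee_fin.
have [->|qN0] := eqVneq q 0%R; first by rewrite powR_ge0.
have {}q0 : (0 < q)%R by rewrite lt_neqAle eq_sym qN0.
rewrite lne_EFin// -EFinM lte_fin ltr_ndivlMr// => qs.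
by rewrite /powR gt_eqF// -[leLHS]lnK// ler_expR ltW.
Qed.

(** For [r < 1] the logarithms are negative, so a local dimension above [t] at
    [x] bounds the masses of all small balls around [x].  The radius below which
    the bound holds is made uniform by the countable decomposition into the
    sets [A k]; on subsets of these, covering masses are at most covering
    numbers times [r^t]. *)
Lemma H10_lower_eq0 t E : (0 <= t)%R -> HS_H t E = 0 ->
  H10 nu [set x | E x /\ t%:E < lower_local_dim nu x] = 0.
Proof.
move=> t0 E0; set X := [set _ | _].
pose A k := [set x | E x /\
  forall r, (0 < r < k.+1%:R^-1)%R -> nu (eball x r) <= (r `^ t)%:E].
apply: (@inf_countable_covers_eq0_bigcup _ _ _ _ A); first exact: H10bar_ge0.
  move=> x [Ex /near_lt_limf_einf/near0_rightP[e e0 tx]].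
  exists (Num.truncn (Num.min e 1%R)^-1%R) => //; split => // r /andP[r0 rk].
  have : (r < Num.min e 1%R)%R.
    have m0 : (0 < Num.min e 1%R)%R by rewrite lt_min e0/=.
    apply: lt_trans rk _; rewrite invf_plt ?posrE//.
    exact: truncnS_gt.
  by rewrite lt_min => /andP[re r1]; apply: eball_mass_le_powR;
     [rewrite r0|apply: tx; rewrite r0].
move=> k; apply/eqP; rewrite eq_le inf_countable_covers_ge0 ?andbT; last first.
  exact: H10bar_ge0.
apply/lee_addgt0Pr => e e0; rewrite add0e.
have [G EG /ltW Ge] := inf_countable_covers_eq0_cover E0 e0.
apply: le_trans Ge.
apply: (@le_trans _ _ (\sum_(i <oo) H10bar nu (A k `&` G i))).
  apply: inf_countable_covers_le_sum => x Ax.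
  by have [i _ Gx] := EG _ Ax.1; exists i.
apply: lee_nneseries => [i _ _|i _]; first exact: H10bar_ge0.
apply: ge_ereal_sup => _ [F FAG <-].
apply: (@le_trans _ _ (HS_L t F)); last first.
  by apply: sup_subsets_ge => x /FAG[].
apply: le_limf_einf.
have k0 : (0 < k.+1%:R^-1 :> R)%R by rewrite invr_gt0.
apply: filterS (near0_lt k0) => r rk; have /andP[r0 _] := rk.
apply: (@le_trans _ _ (covering_number r F * (r `^ t)%:E)).
  apply: covering_mass_le_number; first exact: powR_gt0.
  by move=> x /FAG[[_ Ax] _]; exact: Ax.
apply: lee_wpmul2l.
  by apply: le_ereal_inf_tmp => _ [C _ <-]; exact: counting_ge0.
by rewrite lee_fin ge0_ler_powR ?nnegrE//; lra.
Qed.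

(** The gap between [t] and [s] makes the measures of the neighbourhoods
    obtained at the scales [2^-k] decay like [2^(-k(s-t))].  Infinitely many
    scales are good for each point of [X], so the union over any tail of scales
    still contains [X]. *)
Lemma exists_small_open_upper s t X F (e : R) : (0 <= t < s)%R ->
  HS_Pbar t F < +oo -> X `<=` F ->
  (forall x, X x -> s%:E < upper_local_dim nu x) -> (0 < e)%R ->
  exists U, [/\ open U, X `<=` U & nu U <= e%:E].
Proof.
move=> /andP[t0 ts] Foo XF Xs e0.
have [K [K0 [d d0 FK]]] : exists K : R, (0 < K)%R /\ exists2 d : R, (0 < d)%R &
    forall r, (0 < r < d)%R -> packing_number r F * ((2 * r) `^ t)%:E < K%:E.
  have P0 : 0 <= HS_Pbar t F.
    apply: limf_esup_ge0 => [|r]; first exact: filter_not_empty.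
    by rewrite mule_ge0 ?packing_number_ge0// lee_fin powR_ge0.
  exists (fine (HS_Pbar t F) + 1)%R; split.
    by rewrite ltr_wpDl// fine_ge0.
  apply: near0_rightP; apply: near_limf_esup_lt.
  by rewrite -[ltLHS]fineK ?ge0_fin_numE// lte_fin ltrDl.
pose q : R := (2^-1 `^ (s - t))%R.
have q01 : (0 <= q < 1)%R.
  rewrite powR_ge0/= /q /powR gt_eqF// expR_lt1 pmulr_rlt0 ?subr_gt0//.
  by apply: ln_lt0; lra.
pose c : R := (#|grid_colour n|%:R * K * 2 `^ (s - t))%R.
have c0 : (0 <= c)%R by rewrite !mulr_ge0// ?powR_ge0// ltW.
(* The measures from the scale k0 on sum to at most c q^k0 / (1 - q). *)
have [k0 [k0d k0e]] : exists k0, (dyadic k0 < d)%R /\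
    (c * q ^+ k0 * (1 - q)^-1 <= e)%R.
  have sc := near_dyadic_lt d0.
  have qe : \forall k \near \oo, (c * q ^+ k * (1 - q)^-1 <= e)%R.
    have : (c * q ^+ k * (1 - q)^-1)%R @[k --> \oo] --> (c * 0 * (1 - q)^-1)%R.
      apply: cvgM; last exact: cvg_cst.
      apply: cvgM; first exact: cvg_cst.
      by apply: cvg_expr; case/andP: q01 => ? ?; rewrite ger0_norm.
    rewrite mulr0 mul0r => /cvgrPdist_lt/(_ _ e0); apply: filterS => k.
    by rewrite sub0r normrN => /ltW; apply: le_trans; exact: ler_norm.
  by have [k [? ?]] := filter_ex (filterI sc qe); exists k.
(* The threshold is (2 * 2^-k)^s instead of (2^-k)^s because rounding a
   radius down to a power of 1/2 loses a factor below 2. *)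
pose Y k := X `&` [set x | nu (eball x (dyadic k)) <= ((2 * dyadic k) `^ s)%:E].
have [U YU] : {U : nat -> set 'rV[R]_n & forall j,
    [/\ open (U j), Y (k0 + j)%N `<=` U j &
      nu (U j) <= (c * q ^+ (k0 + j))%:E]}.
  apply: (@choice _ _ (fun j V => [/\ open V, Y (k0 + j)%N `<=` V &
    nu V <= (c * q ^+ (k0 + j))%:E])) => j; set k := (k0 + j)%N.
  have kd : (0 < (dyadic k : R) < d)%R.
    apply/andP; split; first exact: dyadic_gt0.
    by apply: le_lt_trans k0d; rewrite le_dyadic// leq_addr.
  have k2 : (0 < 2 * dyadic k :> R)%R by rewrite mulr_gt0// dyadic_gt0.
  have FKk := FK _ kd.
  have Ffin : packing_number (dyadic k) F < +oo.
    rewrite ltey; apply/eqP => Fy; move: FKk.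
    by rewrite Fy gt0_mulye ?lte_fin ?powR_gt0.
  have YF : packing_number (dyadic k) (Y k) <= packing_number (dyadic k) F.
    by apply: le_packing_number => x [/XF].
  have [V [oV YV nuV]] := exists_open_le_packing_number (@dyadic_gt0 R k)
    (powR_gt0 s k2) (le_lt_trans YF Ffin) (fun x (Yx : Y k x) => Yx.2).
  exists V; split => //; apply: le_trans nuV _.
  have s0 : (0 <= (2 * dyadic k) `^ s :> R)%R by rewrite powR_ge0.
  apply: (@le_trans _ _ (#|grid_colour n|%:R%:E * packing_number (dyadic k) F *
      ((2 * dyadic k) `^ s)%:E)).
    by apply: lee_wpmul2r; [rewrite lee_fin|apply: lee_wpmul2l].
  (* One factor (2 * 2^-k)^t absorbs the growth of the packing number. *)
  have -> : (s = t + (s - t))%R by ring.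
  rewrite powRD; last by rewrite (gt_eqF k2) implybT.
  rewrite EFinM muleA -(muleA _ (packing_number _ _)).
  have -> :
      (c * q ^+ k = #|grid_colour n|%:R * K * (2 * dyadic k) `^ (s - t))%R.
    by rewrite powR_dyadic /c mulrA.
  rewrite !EFinM; apply: lee_wpmul2r; first by rewrite lee_fin powR_ge0.
  by apply: lee_wpmul2l => //; exact: ltW.
exists (\bigcup_j U j); split.
- by apply: bigcup_open => j _; have [] := YU j.
- move=> x Xx; pose h := Num.min (dyadic k0 : R) 1%R.
  have h0 : (0 < h)%R by rewrite lt_min dyadic_gt0/=.
  have [r /= /andP[r0 rh] sr] :=
    frequently_lt_limf_esup (near0_lt h0) (Xs x Xx).
  move: rh; rewrite lt_min => /andP[rk0 r1].
  have [|k k0k /andP[kr rk]] := @exists_dyadic_scale R r k0.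
    by rewrite r0.
  exists (k - k0)%N => //; have [_ sub _] := YU (k - k0)%N; apply: sub.
  rewrite subnKC//; split => //=.
  apply: (@le_trans _ _ (nu (eball x r))).
    apply: le_measure; last exact: le_eball.
      by apply: mem_set; exact: measurable_eball.
    by apply: mem_set; exact: measurable_eball.
  apply: le_trans (eball_mass_le_powR _ sr) _; first by rewrite r0.
  by rewrite lee_fin ge0_ler_powR ?nnegrE ?ltW//; lra.
have mU : measurable (\bigcup_j U j : set (borel_space R n)).
  by apply: measurable_open; apply: bigcup_open => j _; have [] := YU j.
apply: (@le_trans _ _ (\sum_(j <oo) (c * q ^+ k0 * q ^+ j)%:E)).
  apply: le_trans (@measure_sigma_subadditive _ _ _ nu _ U _ mU _) _ => //.
    by move=> j; apply: measurable_open; have [] := YU j.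
  apply: lee_nneseries => // j _; rewrite -mulrA -exprD.
  by have [] := YU j.
apply: lime_le.
  apply: is_cvg_nneseries => j _ _.
  case/andP: q01 => q0 _; rewrite lee_fin.
  by do 2?apply: mulr_ge0 => //; exact: exprn_ge0.
apply: nearW => m; rewrite sumEFin lee_fin -mulr_sumr.
apply: le_trans k0e; apply: ler_wpM2l; last exact: sum_geometric_le.
by rewrite mulr_ge0// exprn_ge0//; case/andP: q01.
Qed.

(** A cover along which the packing premeasures are summable consists of pieces
    of finite premeasure, and each piece is null by the Borel-Cantelli
    argument. *)
Lemma H10_upper_eq0 s t E : (0 <= t < s)%R -> HS_P t E = 0 ->
  H10 nu [set x | E x /\ s%:E < upper_local_dim nu x] = 0.
Proof.
move=> ts E0; set X := [set _ | _].
have Pbar0 F : 0 <= HS_Pbar t F.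
  apply: limf_esup_ge0 => [|r]; first exact: filter_not_empty.
  by rewrite mule_ge0 ?packing_number_ge0// lee_fin powR_ge0.
have [G EG Ge] := inf_countable_covers_eq0_cover E0 ltr01.
apply: (@inf_countable_covers_eq0_bigcup _ _ _ _ (fun i => X `&` G i)).
- exact: H10bar_ge0.
- by move=> x Xx; have [i _ Gx] := EG _ Xx.1; exists i.
move=> i; apply: H10_eq0_open => e e0.
apply: (@exists_small_open_upper s t _ (G i)) => //.
  apply: le_lt_trans (lt_trans Ge (ltry 1%R)).
  rewrite (@nneseriesD1 _ _ i)//.
  by rewrite leeDl// nneseries_ge0.
by move=> x [[_ ?] _].
Qed.

End LocalDimensions.

Theorem theorem5 (R : realType) (n : nat)
    (nu : probability (borel_space R n) R)
    (nu_compact : compact (supp nu))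
    (E : set 'rV[R]_n) (E_supp : E `<=` supp nu)
    (pi_E_gt0 : 0 < H10 nu E) :
  ess_sup_on (H10 nu) E (lower_local_dim nu) <= lower_dim_MB E /\
  ess_sup_on (H10 nu) E (upper_local_dim nu) <= upper_dim_MB E.
Proof.
split; apply: le_ereal_inf_tmp => _ [t [t0 Et0] <-].
  by apply: ereal_inf_lbound; exact: H10_lower_eq0.
apply/lee_addgt0Pr => e e0; rewrite -EFinD.
apply: ereal_inf_lbound; apply: (@H10_upper_eq0 _ _ _ _ t) => //.
by rewrite t0 ltrDl.
Qed.
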